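(* Let $(G,w)$ be a weighted graph and let $\Phi\colon \mathbb{R}^+\times\mathbb{R}^+\to\mathbb{R}^+$ be a triangle function satisfying the standing conditions (1)–(3) listed in the context and continuous in both variables. Then the following statements are equivalent. (i) The weight $w$ is $\Phi$-pseudosemimetrizable, i.e. there exists a $\Phi$-pseudosemimetric $d\colon V(G)\times V(G)\to\mathbb{R}^+$ such that $w(\{u,v\})=d(u,v)$ for all $\{u,v\}\in E(G)$. (ii) The equality $w(\{u,v\})=d_{\Phi}^w(u,v)$ holds for all $\{u,v\}\in E(G)$. (iii) For every cycle $C\subseteq G$ and for every edge $e\in E(C)$ the inequality $w(e)\leqslant w_{\Phi}(C\setminus e)$ holds, where $C\setminus e$ is the path obtained from $C$ by the removal of the edge $e$.
   Context: $\mathbb{R}^+=[0,\infty)$. A graph $G=(V(G),E(G))$ is simple and may be finite or infinite, with $V(G)\neq\varnothing$; edges are two-element subsets of $V(G)$; paths and cycles are finite and simple. A weighted graph $(G,w)$ is a graph $G$ together with a function $w\colon E(G)\to\mathbb{R}^+$. A pseudosemimetric on a nonempty set $X$ is a function $d\colon X\times X\to\mathbb{R}^+$ with $d(x,x)=0$ and $d(x,y)=d(y,x)$ for all $x,y\in X$. A triangle function is a function $\Phi\colon\mathbb{R}^+\times\mathbb{R}^+\to\mathbb{R}^+$ that is symmetric ($\Phi(x,y)=\Phi(y,x)$), monotone increasing (in the non-strict sense) in each argument, and satisfies $\Phi(0,0)=0$. A pseudosemimetric $d$ on $X$ is a $\Phi$-pseudosemimetric if $d(x,y)\leqslant\Phi(d(x,z),d(y,z))$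 for all $x,y,z\in X$. For nonnegative reals put $\Phi^*(x_1)=x_1$, $\Phi^*(x_1,x_2)=\Phi(x_1,x_2)$, and $\Phi^*(x_1,\dots,x_n)=\Phi(x_1,\Phi^*(x_2,\dots,x_n))$ for $n\geqslant 3$. Standing conditions on $\Phi$: (1) $\Phi(x,\Phi(y,z))=\Phi(z,\Phi(x,y))$ for all $x,y,z\in\mathbb{R}^+$; (2) $\Phi^*(a_1,\dots,a_n)\leqslant\Phi(\Phi^*(b_1,\dots,b_p),\Phi^*(c_1,\dots,c_q))$ whenever $n,p,q\geqslant1$ and $A=[a_1,\dots,a_n]$, $B=[b_1,\dots,b_p]$, $C=[c_1,\dots,c_q]$ are multisets of nonnegative reals with $A\subseteq B\cup C$, where $B\cup C$ denotes the multiset $[b_1,\dots,b_p,c_1,\dots,c_q]$ (multiplicities are added) and inclusion is multiset inclusion; (3) $\Phi(a,b)\geqslant\max\{a,b\}$ for all $a,b\in\mathbb{R}^+$. For a path $P$ in $G$, its $\Phi$-weight is $w_\Phi(P)=0$ if $E(P)=\varnothing$, and $w_\Phi(P)=\Phi^*(w(e_1),\dots,w(e_n))$ otherwise, where $e_1,\dots,e_n$ are all the edges of $P$ (since $\Phi$ is symmetric and satisfies $\Phi(x,\Phi(y,z))=\Phi(z,\Phi(x,y))$ for all $x,y,z\in\mathbb{R}^+$, the value does not depend on the order of the edges). For $u,v$ in the same connected component of $G$, $d_\Phi^w(u,v)=\inf\{w_\Phi(P)\colon P\in\mathcal{P}_{u,v}\}$, where $\mathcal{P}_{u,v}$ is the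 set of all paths in $G$ joining $u$ and $v$ (for $u=v$ this includes the path with no edges). *)

(* Defs.v *)
From HB Require Import structures.
From mathcomp Require Import all_boot all_order all_algebra.
From mathcomp Require Import all_classical all_reals all_analysis.
Set Implicit Arguments.
Unset Strict Implicit.
Unset Printing Implicit Defensive.
Import Order.TTheory GRing.Theory Num.Theory.
Import numFieldNormedType.Exports.
Local Open Scope classical_set_scope.
Local Open Scope ring_scope.

(* Functions with arguments or values in [0, +oo) are encoded as functions to
   and from the whole of R: every condition is restricted to nonnegative
   arguments, so values elsewhere are irrelevant. *)

Record triangle_function (R : realType) (Phi : R -> R -> R) : Prop := {
  tf_ge0 : forall x y, 0 <= x -> 0 <= y -> 0 <= Phi x y;
  tf_sym : forall x y, 0 <= x -> 0 <= y -> Phi x y = Phi y x;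
  tf_monol : forall x x' y, 0 <= x -> 0 <= y -> x <= x' -> Phi x y <= Phi x' y;
  tf_monor : forall x y y', 0 <= x -> 0 <= y -> y <= y' -> Phi x y <= Phi x y';
  tf_00 : Phi 0 0 = 0 }.

Record pseudosemimetric (R : realType) (X : Type) (d : X -> X -> R) : Prop := {
  psm_ge0 : forall x y, 0 <= d x y;
  psm_refl : forall x, d x x = 0;
  psm_sym : forall x y, d x y = d y x }.

Definition Phi_pseudosemimetric (R : realType) (X : Type) (Phi : R -> R -> R)
    (d : X -> X -> R) : Prop :=
  pseudosemimetric d /\ forall x y z, d x y <= Phi (d x z) (d y z).

(* The value 0 on the empty sequence makes the weight of an edgeless path 0. *)
Fixpoint Phi_star (R : realType) (Phi : R -> R -> R) (s : seq R) : R :=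
  match s with
  | [::] => 0
  | [:: x] => x
  | x :: s' => Phi x (Phi_star Phi s')
  end.

Definition Phi_exchange (R : realType) (Phi : R -> R -> R) : Prop :=
  forall x y z, 0 <= x -> 0 <= y -> 0 <= z ->
    Phi x (Phi y z) = Phi z (Phi x y).

(* Multisets are presented by sequences; inclusion compares multiplicities. *)
Definition Phi_submultiset (R : realType) (Phi : R -> R -> R) : Prop :=
  forall a b c : seq R,
    a != [::] -> b != [::] -> c != [::] ->
    {in a, forall x, 0 <= x} -> {in b, forall x, 0 <= x} ->
    {in c, forall x, 0 <= x} ->
    (forall x, (count_mem x a <= count_mem x (b ++ c))%N) ->
    Phi_star Phi a <= Phi (Phi_star Phi b) (Phi_star Phi c).

Definition Phi_ge_max (R : realType) (Phi : R -> R -> R) : Prop :=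
  forall a b, 0 <= a -> 0 <= b -> Num.max a b <= Phi a b.

(* For functions monotone in each argument, this separate continuity is
   equivalent to joint continuity on [0, +oo) x [0, +oo). *)
Definition Phi_continuous (R : realType) (Phi : R -> R -> R) : Prop :=
  (forall y, 0 <= y -> {within `[0, +oo[, continuous (fun x => Phi x y)}) /\
  (forall x, 0 <= x -> {within `[0, +oo[, continuous (fun y => Phi x y)}).

Record sgraph (V : Type) := SGraph {
  edges : set (set V);
  edgesP : forall e, edges e -> exists u v, u <> v /\ e = [set u; v] }.

Section Graph.
Variables (R : realType) (V : choiceType) (G : sgraph V).

Definition weight (w : set V -> R) : Prop := forall e, edges G e -> 0 <= w e.

Definition adj : rel V := fun u v => `[< edges G [set u; v] >].

(* Paths and cycles are given by their vertices, in order of traversal. *)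
Definition is_path (s : seq V) : bool :=
  [&& s != [::], sorted adj s & uniq s].

Definition paths_joining (u v : V) : set (seq V) :=
  [set s | [/\ is_path s, head u s = u & last v s = v]].

Definition path_edges (s : seq V) : seq (set V) :=
  if s is x :: p then pairmap (fun u v => [set u; v]) x p else [::].

Definition is_cycle (c : seq V) : Prop := (3 <= size c)%N /\ ucycle adj c.

Definition cycle_edges (c : seq V) : seq (set V) :=
  [seq [set u; next c u] | u <- c].

(* The i-th edge of c joins c_i to c_(i+1), indices mod size c; removing it
   leaves the path from c_(i+1) around to c_i. *)
Definition cycle_del (c : seq V) (e : set V) : seq V :=
  rot (index e (cycle_edges c)).+1 c.

Definition path_weight (Phi : R -> R -> R) (w : set V -> R) (s : seq V) : R :=
  Phi_star Phi (map w (path_edges s)).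

Definition path_dist (Phi : R -> R -> R) (w : set V -> R) (u v : V) : R :=
  inf [set path_weight Phi w s | s in paths_joining u v].

Definition Phi_pseudosemimetrizable (Phi : R -> R -> R) (w : set V -> R) :=
  exists d : V -> V -> R, Phi_pseudosemimetric Phi d /\
    forall u v, edges G [set u; v] -> w [set u; v] = d u v.

Lemma cycle_edges_rot (n : nat) (c : seq V) : uniq c ->
  cycle_edges (rot n c) = rot n (cycle_edges c).
Proof.
by move=> uc; rewrite -map_rot; apply: eq_map => u; rewrite next_rot.
Qed.

Lemma path_edges_closed (x : V) (p : seq V) : uniq (x :: p) ->
  rcons (path_edges (x :: p)) [set last x p; x] = cycle_edges (x :: p).
Proof.
move=> up; apply: (@eq_from_nth _ set0).
  by rewrite size_rcons size_pairmap size_map.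
rewrite size_rcons size_pairmap => i ip.
rewrite nth_rcons size_pairmap (nth_map x)// next_nth mem_nth// index_uniq//.
case: ltnP => [ilt|ige]; first by rewrite (nth_pairmap x).
have -> : i = size p by apply/eqP; rewrite eqn_leq -ltnS ip ige.
by rewrite eqxx (nth_default x (leqnn _)) nth_last.
Qed.

Lemma cycle_delP (c : seq V) (e : set V) :
  is_cycle c -> e \in cycle_edges c ->
  is_path (cycle_del c e) /\
  perm_eq (e :: path_edges (cycle_del c e)) (cycle_edges c).
Proof.
move=> [_ /andP[cc uc]] ec; set i := index e (cycle_edges c).
have ic : (i < size c)%N by rewrite -(size_map (fun u => [set u; next c u])) index_mem.
have ccd : cycle adj (cycle_del c e) by rewrite rot_cycle.
have ucd : uniq (cycle_del c e) by rewrite rot_uniq.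
have Ecd : cycle_edges (cycle_del c e) = rot i.+1 (cycle_edges c).
  exact: cycle_edges_rot.
case Ed : (cycle_del c e) => [|y p] in ccd ucd Ecd *.
  by move: (size_rot i.+1 c) ic; rewrite -/(cycle_del c e) Ed /= => <-.
split; first by move: ccd; rewrite /is_path ucd /= rcons_path => /andP[-> _].
have lE : [set last y p; y] = e.
  have := congr1 (last set0) Ecd.
  rewrite -path_edges_closed// last_rcons => ->.
  rewrite /rot last_cat (take_nth set0) ?size_map// last_rcons.
  by rewrite nth_index.
rewrite -{1}lE -perm_rcons path_edges_closed// Ecd.
by rewrite perm_rot.
Qed.

End Graph.

(* Main.v *)
Require Import Defs.
From mathcomp Require Import all_boot all_order all_algebra.
From mathcomp Require Import all_classical all_reals all_analysis.
Set Implicit Arguments.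
Unset Strict Implicit.
Unset Printing Implicit Defensive.
Import Order.TTheory GRing.Theory Num.Theory.
Import numFieldNormedType.Exports.
Local Open Scope classical_set_scope.
Local Open Scope ring_scope.

(** Iterating the inequality d(x,y) <= Phi(d(x,z), d(y,z)) along a path bounds
    the distance of its endpoints by its Phi-weight, for every
    Phi-pseudosemimetric d extending w
    ([Phi_pseudosemimetric_le_path_weight]).  Hence, when such a d exists, no
    path between the endpoints of an edge weighs less than the edge, which is
    itself a path: its weight is the path distance.  A cycle is a path between
    the endpoints of an edge closed by that edge, so the equality of weight and
    path distance on edges forces the cycle inequalities
    ([cycle_del_joins]), and conversely the cycle inequalities give the
    equality, since every other path joining adjacent vertices closes to a
    cycle ([path_closes_to_cycle], [edge_le_path_dist]).

    What remains is to build a Phi-pseudosemimetric from the path distance.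
    On a connected component the path distance itself works.  Concatenating a
    path from x to z with a path from z to y and cutting out the detours gives
    a path from x to y whose edges form a submultiset of the edges of the two
    paths ([paths_joining_cat]), so the submultiset condition bounds its weight
    by Phi of the two weights; continuity of Phi then lets both weights tend to
    their infima ([path_dist_triangle]).

    Between components the path distance carries no information.  Choose a base
    point in each component and let c(x) be the distance from x to the base
    point of its component; vertices x, y of different components are put at
    distance Phi(c(x), c(y)), as if all base points were at distance 0 from
    each other.  Associativity of Phi and Phi >= max make this a
    Phi-pseudosemimetric ([Phi_pseudosemimetric_glue]). *)

(** * Iterated triangle functions *)

Section PhiStar.
Variables (R : realType) (Phi : R -> R -> R).
Hypothesis Phi_triangle : triangle_function Phi.
Implicit Types (s t : seq R) (x y z : R).

Lemma Phi_star_cons x s : s != [::] ->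
  Phi_star Phi (x :: s) = Phi x (Phi_star Phi s).
Proof. by case: s. Qed.

Lemma Phi_star_ge0 s : all (>= 0) s -> 0 <= Phi_star Phi s.
Proof.
elim: s => [//|x [|y s] IH] /andP[x0 s0] //.
by rewrite Phi_star_cons// (tf_ge0 Phi_triangle)// IH.
Qed.

Lemma Phi_mono x x' y y' : 0 <= x -> 0 <= y -> x <= x' -> y <= y' ->
  Phi x y <= Phi x' y'.
Proof.
move=> x0 y0 xx' yy'; apply: (le_trans (tf_monol Phi_triangle x0 y0 xx')).
exact: (tf_monor Phi_triangle (le_trans x0 xx') y0 yy').
Qed.

Hypothesis Phi_cond1 : Phi_exchange Phi.

(** The exchange law is associativity up to symmetry. *)
Lemma Phi_assoc x y z : 0 <= x -> 0 <= y -> 0 <= z ->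
  Phi x (Phi y z) = Phi (Phi x y) z.
Proof.
move=> x0 y0 z0; rewrite Phi_cond1// (tf_sym Phi_triangle)//.
exact: (tf_ge0 Phi_triangle).
Qed.

Lemma Phi_left_comm x y z : 0 <= x -> 0 <= y -> 0 <= z ->
  Phi x (Phi y z) = Phi y (Phi x z).
Proof.
move=> x0 y0 z0.
by rewrite Phi_assoc// (tf_sym Phi_triangle x0 y0) -Phi_assoc.
Qed.

Lemma Phi_star_insert x s t : 0 <= x -> all (>= 0) s -> all (>= 0) t ->
  Phi_star Phi (s ++ x :: t) = Phi_star Phi (x :: s ++ t).
Proof.
move=> x0 + t0; elim: s => [//|y s IH]; rewrite [all _ _]/= => /andP[y0 s0].
rewrite !cat_cons (@Phi_star_cons y); last by case: (s).
rewrite {}IH//.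
have : all (>= 0) (s ++ t) by rewrite all_cat s0.
case: (s ++ t) => [_|z r zr0]; first by rewrite /= (tf_sym Phi_triangle).
rewrite !(@Phi_star_cons x)// (@Phi_star_cons y)// Phi_left_comm//.
exact: Phi_star_ge0.
Qed.

(** The Phi-weight of a path depends only on its multiset of edge weights; in
    particular it is the same for a path and its reversal, and for a cycle with
    an edge removed, wherever the traversal starts. *)
Lemma Phi_star_perm s t : all (>= 0) s -> perm_eq s t ->
  Phi_star Phi s = Phi_star Phi t.
Proof.
elim: s t => [|x s IH] t s0 st.
  by move: st; rewrite perm_sym => /perm_nilP ->.
have t0 : all (>= 0) t by rewrite -(perm_all _ st).
have xt : x \in t by rewrite -(perm_mem st) mem_head.
case/splitPr: xt => [t1 t2] in st t0 *.
move: s0 t0; rewrite all_cat /= => /andP[x0 s0] /and3P[t10 _ t20].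
rewrite Phi_star_insert//.
have {}st : perm_eq s (t1 ++ t2).
  rewrite -(perm_cons x) (perm_trans st)//.
  by rewrite -cat1s perm_sym -[x :: _]cat1s perm_catCA.
(* [Phi_star] of a singleton does not apply Phi, so x can only be peeled off
   once both tails are known to be empty or not at the same time. *)
move: (IH _ s0 st) (perm_size st).
by case: s {IH s0 st} => [|y s]; case: (t1 ++ t2) => [|z r] //= ->.
Qed.

Hypothesis Phi_cond2 : Phi_submultiset Phi.

(** The submultiset condition extends to empty sequences because [Phi_star]
    takes the same value on the empty sequence as on the singleton 0; thus
    edgeless paths need no separate treatment. *)
Lemma Phi_star_submultiset s t r :
  all (>= 0) s -> all (>= 0) t -> all (>= 0) r ->
  (forall x, (count_mem x s <= count_mem x (t ++ r))%N) ->
  Phi_star Phi s <= Phi (Phi_star Phi t) (Phi_star Phi r).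
Proof.
move=> s0 t0 r0 sub.
have [->|sN] := eqVneq s [::].
  by apply: (tf_ge0 Phi_triangle); exact: Phi_star_ge0.
pose pad q : seq R := if q is [::] then [:: 0] else q.
have padE q : Phi_star Phi (pad q) = Phi_star Phi q by case: q.
have padN q : pad q != [::] by case: q.
have pad0 q : all (>= 0) q -> {in pad q, forall x, 0 <= x}.
  by move=> q0; apply/allP; case: q q0 => //= _; rewrite lexx.
have padC q x : (count_mem x q <= count_mem x (pad q))%N by case: q.
rewrite -(padE t) -(padE r); apply: Phi_cond2 => //.
- exact/allP.
- exact: pad0.
- exact: pad0.
by move=> x; apply: (leq_trans (sub x)); rewrite !count_cat leq_add.
Qed.

End PhiStar.

(** * Lower bounds at an infimum *)

(** The infimum of A is a limit of points of A, and the bound passes to the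
    limit by continuity. *)
Lemma le_at_inf (R : realType) (f : R -> R) (A : set R) (t : R) :
  {within `[0, +oo[, continuous f} -> A !=set0 -> (forall a, A a -> 0 <= a) ->
  (forall a, A a -> t <= f a) -> t <= f (inf A).
Proof.
move=> /subspace_continuousP fc A0 A_ge0 tf; rewrite leNgt; apply/negP => ft.
have infA0 : 0 <= inf A by apply: lb_le_inf.
have hinf : has_inf A by split=> //; exists 0 => a /A_ge0.
have {}fc : f @ within `[0, +oo[ (nbhs (inf A)) --> f (inf A).
  by apply: fc; rewrite /= in_itv/= infA0.
have /nbhs_ballP[e /= e0 He] :
    within `[0, +oo[ (nbhs (inf A)) [set y | f y < t].
  exact: (cvgr_lt _ fc).
have [a Aa ae] := inf_adherent e0 hinf.
have : f a < t.
  apply: He; last by rewrite /= in_itv/= A_ge0.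
  rewrite /ball/= distrC ger0_norm ?subr_ge0 ?(ge_inf hinf.2)//.
  by rewrite ltrBlDl.
by rewrite ltNge tf.
Qed.

(** * Paths and cycles *)

Section Paths.
Variables (V : choiceType) (G : sgraph V).
Implicit Types (u v x y : V) (p s : seq V).

Lemma adj_sym x y : adj G x y = adj G y x.
Proof. by rewrite /adj setUC. Qed.

Lemma adj_neq x y : adj G x y -> x != y.
Proof.
move=> /asboolP /edgesP[u [v [uv xyuv]]]; apply/eqP => xy; apply: uv.
have xE a : [set u; v] a -> a = x by rewrite -xyuv -xy => -[].
by rewrite (xE u (or_introl erefl)) (xE v (or_intror erefl)).
Qed.

Lemma paths_joiningP u v s : paths_joining G u v s <->
  exists p, [/\ s = u :: p, path (adj G) u p, uniq (u :: p) & last u p = v].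
Proof.
split=> [[]|[p [-> up uup lp]]]; last by split; rewrite // /is_path uup andbT.
by case: s => [//|x p] /and3P[_ xp uxp] /= xu lp; exists p; subst x.
Qed.

Lemma paths_joining_refl u : paths_joining G u u [:: u].
Proof. by apply/paths_joiningP; exists [::]. Qed.

Lemma paths_joining_edge u v : edges G [set u; v] ->
  paths_joining G u v [:: u; v].
Proof.
move=> uv; have auv : adj G u v by apply/asboolP.
by apply/paths_joiningP; exists [:: v]; split; rewrite //= ?auv// inE adj_neq.
Qed.

Lemma path_edges_rcons x p y :
  path_edges (rcons (x :: p) y) = rcons (path_edges (x :: p)) [set last x p; y].
Proof. by rewrite /= -!cats1 pairmap_cat. Qed.

Lemma path_edges_rev s : path_edges (rev s) = rev (path_edges s).
Proof.
elim: s => [//|x [//|y p] IH].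
rewrite rev_cons -(revK (rcons _ _)).
case E : (rev (y :: p)) => [|z q].
  by move: (congr1 size E); rewrite size_rev.
rewrite revK path_edges_rcons -E IH -rev_cons /=.
have -> : last z q = y.
  by rewrite -[last z q]/(last z (z :: q)) -E rev_cons last_rcons.
by rewrite setUC.
Qed.

Lemma paths_joining_rev u v s :
  paths_joining G u v s -> paths_joining G v u (rev s).
Proof.
move=> /paths_joiningP[p [-> up uup lp]]; split.
- apply/and3P; split; first by rewrite -size_eq0 size_rev.
    rewrite rev_sorted /= (eq_path (e' := adj G))// => x y; exact: adj_sym.
  by rewrite rev_uniq.
- by rewrite lastI rev_rcons.
- by rewrite rev_cons last_rcons.
Qed.

Lemma path_edges_edge x p : path (adj G) x p ->
  {in path_edges (x :: p), forall e, edges G e}.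
Proof.
elim: p x => [//|y p IH] x /= /andP[xy yp] e.
by rewrite inE => /orP[/eqP ->|/(IH _ yp)//]; apply/asboolP.
Qed.

(** Loop erasure, one vertex at a time: when the first vertex of the walk recurs
    in the path extracted from the rest, that path is cut at the recurrence.
    Edges are only ever dropped, which is what makes the edges of the result a
    subsequence, hence a submultiset, of those of the walk. *)
Lemma walk_to_path x p : path (adj G) x p ->
  exists s, paths_joining G x (last x p) s /\
            subseq (path_edges s) (path_edges (x :: p)).
Proof.
elim: p x => [|y p IH] x /=.
  by exists [:: x]; split=> //; exact: paths_joining_refl.
move=> /andP[xy /IH[s [/paths_joiningP[q [{s}-> yq uyq <-]] sub]]].
have [xq|xNq] := boolP (x \in y :: q).
  case/splitPl: xq yq uyq sub => q1 q2 lq1.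
  rewrite cat_path last_cat -cat_cons cat_uniq lq1.
  move=> /andP[_ xq2] /and3P[_ Hq uq2].
  rewrite /= pairmap_cat lq1 => sub; exists (x :: q2); split.
    apply/paths_joiningP; exists q2; split=> //=; rewrite uq2 andbT.
    apply/negP => xq2'; move/negP: Hq; apply; apply/hasP; exists x => //=.
    by rewrite -lq1 mem_last.
  apply: subseq_trans (subseq_cons _ _); apply: subseq_trans sub.
  exact: suffix_subseq.
exists [:: x, y & q]; split; last by rewrite /= eqxx.
by apply/paths_joiningP; exists (y :: q); split; rewrite //= ?xy// xNq.
Qed.

Lemma paths_joining_cat x y z s t :
  paths_joining G x z s -> paths_joining G z y t ->
  exists r, paths_joining G x y r /\
            subseq (path_edges r) (path_edges s ++ path_edges t).
Proof.
move=> /paths_joiningP[p [-> xp _ lp]] /paths_joiningP[q [-> zq _ lq]].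
have /walk_to_path[r] : path (adj G) x (p ++ q) by rewrite cat_path xp lp.
by rewrite last_cat lp lq /= pairmap_cat lp; exists r.
Qed.

(** The removed edge closes the path that remains, because adding either one to
    the edges of that path gives the same multiset, the edges of the cycle. *)
Lemma cycle_del_joins c e : is_cycle G c -> e \in cycle_edges c ->
  exists u v, [/\ e = [set u; v], edges G [set u; v] &
                  paths_joining G u v (cycle_del c e)].
Proof.
move=> cc ec; have [ps pe] := cycle_delP cc ec.
have [_ /andP[cadj cu]] := cc.
have eG : edges G e.
  by case/mapP: ec => u uc ->; have /asboolP := next_cycle cadj uc.
have : perm_eq (cycle_edges (cycle_del c e)) (cycle_edges c).
  by rewrite cycle_edges_rot// perm_rot.
move: ps pe; rewrite /is_path; case: (cycle_del c e) => [//|x p].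
move=> /and3P[_ xp uxp] pe; rewrite -path_edges_closed// -(permPr pe).
(* Both multisets of edges of the cycle share the edges of the path x :: p, so
   the two remaining edges agree. *)
rewrite perm_rcons -[_ :: _]cat1s -[e :: _]cat1s perm_cat2r => /perm_mem ee.
have E : e = [set x; last x p].
  by have := ee e; rewrite !inE eqxx setUC => /eqP.
exists x, (last x p); rewrite -E; split=> //; apply/paths_joiningP.
by exists p.
Qed.

(** Cycles have at least three vertices, so the path that consists of the edge
    itself is the only one between its endpoints that does not close. *)
Lemma path_closes_to_cycle u v s : edges G [set u; v] ->
  paths_joining G u v s -> s = [:: u; v] \/
  [/\ is_cycle G s, [set u; v] \in cycle_edges s &
      perm_eq (path_edges (cycle_del s [set u; v])) (path_edges s)].
Proof.
move=> euv /paths_joiningP[p [-> up uup lp]].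
have auv : adj G u v by apply/asboolP.
have [-> |p1] := eqVneq p [:: v]; [by left|right].
have cc : is_cycle G (u :: p).
  split; last by rewrite /ucycle uup /= rcons_path up lp adj_sym auv.
  case: p p1 lp {up uup} => [|x [|y p]] //=.
    by move=> _ uv; move: (adj_neq auv); rewrite uv eqxx.
  by move=> /eqP + xv; rewrite xv.
have E : rcons (path_edges (u :: p)) [set u; v] = cycle_edges (u :: p).
  by rewrite -path_edges_closed// lp setUC.
have ec : [set u; v] \in cycle_edges (u :: p) by rewrite -E mem_rcons mem_head.
split=> //; have [_] := cycle_delP cc ec.
by rewrite -E perm_sym perm_rcons perm_cons perm_sym.
Qed.

End Paths.

(** * The path distance *)

Section PathDist.
Variables (R : realType) (V : choiceType) (G : sgraph V).
Variables (w : set V -> R) (Phi : R -> R -> R).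
Hypothesis w_weight : weight G w.
Hypothesis Phi_triangle : triangle_function Phi.

Lemma path_weights_ge0 u v s : paths_joining G u v s ->
  all (>= 0) (map w (path_edges s)).
Proof.
move=> /paths_joiningP[p [-> up _ _]]; apply/allP => _ /mapP[e ep ->].
by apply: w_weight; exact: path_edges_edge up _ ep.
Qed.

Lemma path_weight_ge0 u v s : paths_joining G u v s ->
  0 <= path_weight Phi w s.
Proof. by move=> /path_weights_ge0; exact: Phi_star_ge0. Qed.

Lemma path_dist_le u v s : paths_joining G u v s ->
  path_dist G Phi w u v <= path_weight Phi w s.
Proof.
move=> us; apply: ge_inf; last by exists s.
by exists 0 => _ [t ut <-]; exact: path_weight_ge0 ut.
Qed.

Lemma le_path_dist u v t : paths_joining G u v !=set0 ->
  (forall s, paths_joining G u v s -> t <= path_weight Phi w s) ->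
  t <= path_dist G Phi w u v.
Proof.
move=> [s us] H; apply: lb_le_inf; first by exists (path_weight Phi w s), s.
by move=> _ [r ur <-]; exact: H.
Qed.

Lemma path_dist_ge0 u v : paths_joining G u v !=set0 ->
  0 <= path_dist G Phi w u v.
Proof. by move=> uv; apply: le_path_dist => // s; exact: path_weight_ge0. Qed.

Lemma path_dist_refl u : path_dist G Phi w u u = 0.
Proof.
apply/eqP; rewrite eq_le (path_dist_le (paths_joining_refl G u))/=.
by apply: path_dist_ge0; exists [:: u]; exact: paths_joining_refl.
Qed.

(** The triangle inequality iterated along the path; monotonicity of Phi carries
    the bound on the tail. *)
Lemma Phi_pseudosemimetric_le_path_weight (d : V -> V -> R) u v s :
  Phi_pseudosemimetric Phi d ->
  (forall x y, edges G [set x; y] -> w [set x; y] = d x y) ->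
  paths_joining G u v s -> d u v <= path_weight Phi w s.
Proof.
move=> [[d0 drefl dsym] dtri] wd /paths_joiningP[p [{s}-> up _ <-]] {v}.
rewrite /path_weight; elim: p u up => [|y p IH] u /=; first by rewrite drefl.
move=> /andP[/asboolP /wd uy /IH {}IH]; rewrite uy.
case: p IH => [//|z p] IH.
apply: (le_trans (dtri _ _ y)); rewrite (dsym (last _ _) y).
exact: (tf_monor Phi_triangle (d0 _ _) (d0 _ _) IH).
Qed.

Hypothesis Phi_cond1 : Phi_exchange Phi.

Lemma path_dist_sym u v : path_dist G Phi w u v = path_dist G Phi w v u.
Proof.
rewrite /path_dist; congr inf.
have H x y : [set path_weight Phi w s | s in paths_joining G x y] `<=`
             [set path_weight Phi w s | s in paths_joining G y x].
  move=> _ [s xs <-]; exists (rev s); first exact: paths_joining_rev.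
  rewrite /path_weight path_edges_rev map_rev; apply/esym.
  apply: (Phi_star_perm Phi_triangle Phi_cond1 (path_weights_ge0 xs)).
  by rewrite perm_sym perm_rev.
by apply/seteqP; split; exact: H.
Qed.

Lemma edge_le_path_dist u v :
  (forall c, is_cycle G c -> forall e, e \in cycle_edges c ->
     w e <= path_weight Phi w (cycle_del c e)) ->
  edges G [set u; v] -> w [set u; v] <= path_dist G Phi w u v.
Proof.
move=> cycles euv; apply: le_path_dist.
  by exists [:: u; v]; exact: paths_joining_edge.
move=> s us; have [->//|[cs ec pe]] := path_closes_to_cycle euv us.
apply: (le_trans (cycles _ cs _ ec)).
rewrite le_eqVlt; apply/orP; left; apply/eqP.
have pw := perm_map w pe.
apply: (Phi_star_perm Phi_triangle Phi_cond1 _ pw).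
by rewrite (perm_all _ pw); exact: path_weights_ge0 us.
Qed.

Hypothesis Phi_cond2 : Phi_submultiset Phi.

Lemma path_dist_le_Phi x y z s t :
  paths_joining G x z s -> paths_joining G z y t ->
  path_dist G Phi w x y <= Phi (path_weight Phi w s) (path_weight Phi w t).
Proof.
move=> xs zt; have [r [xr sub]] := paths_joining_cat xs zt.
apply: (le_trans (path_dist_le xr)).
apply: (Phi_star_submultiset Phi_triangle Phi_cond2).
- exact: path_weights_ge0 xr.
- exact: path_weights_ge0 xs.
- exact: path_weights_ge0 zt.
by move=> a; rewrite -map_cat; apply: leq_count_subseq; exact: map_subseq.
Qed.

Hypothesis Phi_cont : Phi_continuous Phi.

(** Continuity in one variable at a time suffices: the weight of the path from x
    to z goes to its infimum for each fixed path from z to y, and the weight of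
    the latter goes to its own infimum afterwards. *)
Lemma path_dist_triangle x y z :
  paths_joining G x z !=set0 -> paths_joining G z y !=set0 ->
  path_dist G Phi w x y <= Phi (path_dist G Phi w x z) (path_dist G Phi w z y).
Proof.
move=> xz zy; have [contl contr] := Phi_cont.
have weights_ge0 u v : forall a,
    [set path_weight Phi w s | s in paths_joining G u v] a -> 0 <= a.
  by move=> _ [s us <-]; exact: path_weight_ge0 us.
have weights_neq0 u v : paths_joining G u v !=set0 ->
    [set path_weight Phi w s | s in paths_joining G u v] !=set0.
  by move=> [s us]; exists (path_weight Phi w s), s.
(* The outer infimum is the one in the second argument of Phi. *)
apply: (le_at_inf (contr _ (path_dist_ge0 xz))) => //.
- exact: weights_neq0.
- exact: weights_ge0.
move=> _ [t zt <-].
apply: (le_at_inf (contl _ (path_weight_ge0 zt))) => //.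
- exact: weights_neq0.
- exact: weights_ge0.
by move=> _ [s xs <-]; exact: path_dist_le_Phi xs zt.
Qed.

End PathDist.

(** * Gluing pseudosemimetrics across components *)

(** Every class of E gets a base point, and the base points of distinct classes
    are treated as being at distance 0 from each other.  A triangle with two
    vertices in one class then reduces to the one with the third vertex
    replaced by a base point, using associativity of Phi, unless the third
    vertex is the intermediate point z; in that case, as when all three classes
    differ, a detour through another class is no shorter because
    Phi >= max. *)
Lemma Phi_pseudosemimetric_glue (R : realType) (X : pointedType)
    (Phi : R -> R -> R) (E : X -> X -> Prop) (d : X -> X -> R) :
  triangle_function Phi -> Phi_exchange Phi -> Phi_ge_max Phi ->
  (forall x, E x x) -> (forall x y, E x y -> E y x) ->
  (forall x y z, E x y -> E y z -> E x z) ->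
  (forall x y, E x y -> 0 <= d x y) -> (forall x, d x x = 0) ->
  (forall x y, d x y = d y x) ->
  (forall x y z, E x z -> E z y -> d x y <= Phi (d x z) (d z y)) ->
  exists D : X -> X -> R, Phi_pseudosemimetric Phi D /\
    forall x y, E x y -> D x y = d x y.
Proof.
move=> Phi_tri Phi_exch Phi_max Exx Esym Etr d0 dxx dsym dtri.
pose base x := get [set y | E x y].
have E_base x : E x (base x) by apply: (@getPex _ [set y | E x y]); exists x.
have base_eq x y : E x y -> base x = base y.
  move=> xy; congr get; apply/seteqP; split=> z /=; apply: Etr => //.
  exact: Esym.
pose c x := d x (base x).
have c0 x : 0 <= c x by exact: d0.
have c_le x y : E x y -> c x <= Phi (d x y) (c y).
  move=> xy; rewrite /c (base_eq _ _ xy); exact: dtri.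
pose D x y := if `[< E x y >] then d x y else Phi (c x) (c y).
have DE x y : E x y -> D x y = d x y by move=> xy; rewrite /D asboolT.
have DN x y : ~ E x y -> D x y = Phi (c x) (c y).
  by move=> xy; rewrite /D asboolF.
have Dsym x y : D x y = D y x.
  have [xy|xy] := pselect (E x y); first by rewrite !DE//; exact: Esym.
  have yx : ~ E y x by move/Esym.
  by rewrite (DN _ _ xy) (DN _ _ yx) (tf_sym Phi_tri).
exists D; split=> //; split.
  split=> // [x y|x]; last by rewrite DE.
  have [xy|xy] := pselect (E x y); first by rewrite DE ?d0.
  by rewrite DN// (tf_ge0 Phi_tri).
have lel a b : 0 <= a -> 0 <= b -> a <= Phi a b.
  by move=> a0 b0; have := Phi_max _ _ a0 b0; rewrite ge_max => /andP[].
(* Written as D x y <= Phi (D x z) (D z y), split by whether z shares the class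
   of x and that of y. *)
move=> x y z; rewrite (Dsym y).
have [xz|xz] := pselect (E x z); have [zy|zy] := pselect (E z y).
- by rewrite !DE//; [exact: dtri|exact: Etr zy].
- have xy : ~ E x y by move=> xy; apply/zy/(Etr _ _ _ (Esym _ _ xz)).
  rewrite (DE _ _ xz) (DN _ _ zy) (DN _ _ xy) Phi_assoc ?d0//.
  exact/(tf_monol Phi_tri)/c_le.
- have xy : ~ E x y by move=> xy; apply/xz/(Etr _ _ _ xy)/Esym.
  rewrite (DE _ _ zy) (DN _ _ xz) (DN _ _ xy) -Phi_assoc ?d0//.
  apply/(tf_monor Phi_tri) => //; rewrite (tf_sym Phi_tri) ?d0// dsym.
  exact/c_le/Esym.
rewrite (DN _ _ xz) (DN _ _ zy).
have Pc a b : 0 <= Phi (c a) (c b) by exact: (tf_ge0 Phi_tri).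
have lx : c x <= Phi (c x) (c z) by exact: lel.
have ly : c y <= Phi (c z) (c y) by rewrite (tf_sym Phi_tri)//; exact: lel.
have [xy|xy] := pselect (E x y); last by rewrite DN//; exact: Phi_mono.
rewrite DE//; apply: (@le_trans _ _ (Phi (c x) (c y))); last exact: Phi_mono.
have := dtri _ _ _ (E_base x) (Etr _ _ _ (Esym _ _ (E_base x)) xy).
by rewrite [d (base x) y]dsym {2}(base_eq _ _ xy).
Qed.

Theorem theorem4p1 (R : realType) (V : pointedType) (G : sgraph V)
    (w : set V -> R) (Phi : R -> R -> R)
    (w_weight : weight G w)
    (Phi_triangle : triangle_function Phi)
    (Phi_cond1 : Phi_exchange Phi)
    (Phi_cond2 : Phi_submultiset Phi)
    (Phi_cond3 : Phi_ge_max Phi)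
    (Phi_cont : Phi_continuous Phi) :
  [<-> Phi_pseudosemimetrizable G Phi w;
       forall u v : V, edges G [set u; v] ->
         w [set u; v] = path_dist G Phi w u v;
       forall c : seq V, is_cycle G c ->
         forall e : set V, e \in cycle_edges c ->
         w e <= path_weight Phi w (cycle_del c e)].
Proof.
have dist_le_edge u v : edges G [set u; v] ->
    path_dist G Phi w u v <= w [set u; v].
  by move=> /paths_joining_edge/(path_dist_le w_weight Phi_triangle).
tfae.
- move=> [d [d_psm wd]] u v uv; apply/eqP; rewrite eq_le dist_le_edge// andbT.
  apply: le_path_dist; first by exists [:: u; v]; exact: paths_joining_edge.
  by move=> s us; rewrite wd//; exact: Phi_pseudosemimetric_le_path_weight us.
- move=> wE c cc e ec; have [u [v [-> uv us]]] := cycle_del_joins cc ec.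
  by rewrite wE//; exact: path_dist_le us.
move=> cycles.
pose joined u v := paths_joining G u v !=set0.
have joined_sym u v : joined u v -> joined v u.
  by move=> [s us]; exists (rev s); exact: paths_joining_rev.
have joined_trans x y z : joined x y -> joined y z -> joined x z.
  by move=> [s xs] [t yt]; have [r [xr _]] := paths_joining_cat xs yt; exists r.
have [|||||d [d_psm dE]] := @Phi_pseudosemimetric_glue R V Phi joined
    (path_dist G Phi w) Phi_triangle Phi_cond1 Phi_cond3 _ joined_sym
    joined_trans.
- by move=> x; exists [:: x]; exact: paths_joining_refl.
- by move=> x y; exact: path_dist_ge0.
- exact: path_dist_refl.
- exact: path_dist_sym.
- by move=> x y z; exact: path_dist_triangle.
exists d; split=> // u v uv.
have juv : joined u v by exists [:: u; v]; exact: paths_joining_edge.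
rewrite dE//; apply/eqP; rewrite eq_le dist_le_edge// andbT.
exact: edge_le_path_dist.
Qed.
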